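(* Let $k \ge 2$ be an integer and let $G \in \mathcal{G}_2$ be a graph of order $n$ with minimum degree $\delta \ge 3k+3$. If \[ \mu_{n-3}(G) > \frac{9\left(k+\frac{\delta-1}{\delta}\right)}{\delta+1}, \] then $G$ has property $P(k, \delta)$.
   Context: All graphs are finite, undirected and simple. For a graph $G$ with vertex set $V(G)$, $|V(G)|=n$, let $A(G)$ be its adjacency matrix, $D(G)$ the diagonal matrix of vertex degrees, and $L(G)=D(G)-A(G)$ its Laplacian matrix. $\mu_i(G)$ denotes the $i$-th largest eigenvalue of $L(G)$ (counted with multiplicity), so $\mu_1(G)\ge\mu_2(G)\ge\cdots\ge\mu_n(G)$ and $\mu_{n-3}(G)$ is the fourth smallest Laplacian eigenvalue. For disjoint $X,Y\subseteq V(G)$, $e(X,Y)$ is the number of edges of $G$ with one endpoint in $X$ and the other in $Y$. $\kappa'(G)$ is the edge connectivity of $G$. For a positive integer $t$, $\mathcal{G}_t$ is the set of simple graphs $G$ that contain at least $t+1$ non-empty pairwise disjoint proper subsets $V_1,\ldots,V_{t+1}$ of $V(G)$ such that $V(G)\setminus\bigcup_{i=1}^{t+1}V_i\neq\emptyset$ and $\kappa'(G)=e(V_i,V(G)\setminus V_i)$ for every $i=1,\ldots,t+1$. For positive integers $k,d$, a graph $G$ of order $n$ has property $P(k,d)$ if: (a) $G$ contains $k$ pairwise edge-disjoint spanning trees; (b) apart from these $k$ edge-disjoint spanning trees (i.e. edge-disjoint from them), there exists another forest $F$ in $G$ with number of edges $|E(F)|>\frac{d-1}{d}(n-1)$; and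 (c) if $F$ is not a spanning tree of $G$, then $F$ has a component with at least $d$ edges. *)

(* Defs.v *)
From HB Require Import structures.
From mathcomp Require Import all_boot all_order all_algebra all_field.

Set Implicit Arguments.
Unset Strict Implicit.
Unset Printing Implicit Defensive.

Import Order.TTheory GRing.Theory Num.Theory.

Local Open Scope ring_scope.

(* A simple graph is a symmetric irreflexive relation [e] on a finite type [T];
   its edges are the two-element sets [set x; y] with [e x y], and a spanning
   subgraph is given by its set of edges. *)
Section Graphs.

Variable T : finType.

Definition edges (e : rel T) : {set {set T}} :=
  [set [set x; y] | x in T, y in T & e x y].

(* The test [x != y] is needed because [set x; x] = [set x]. *)
Definition edge_rel (F : {set {set T}}) : rel T :=
  [rel x y | (x != y) && ([set x; y] \in F)].

Definition degree (e : rel T) (x : T) : nat := #|[set y | e x y]|.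

(* All degrees are smaller than #|T|, so the default value of the minimum only
   matters for the empty graph. *)
Definition min_degree (e : rel T) : nat :=
  \big[minn/#|T|]_(x : T) degree e x.

Definition edges_between (e : rel T) (X Y : {set T}) : nat :=
  #|[set [set x; y] | x in X, y in Y & e x y]|.

Definition connected_graph (e : rel T) : bool :=
  [forall x, forall y, connect e x y].

(* The least number of edges whose deletion disconnects the graph. As soon as
   there are two vertices, deleting all the edges does so, hence the default
   value of the minimum is harmless; on one vertex the value is 0. *)
Definition edge_connectivity (e : rel T) : nat :=
  \big[minn/#|edges e|]_(S : {set {set T}} |
      (S \subset edges e) && ~~ connected_graph (edge_rel (edges e :\: S)))
    #|S|.

Definition in_class_G (t : nat) (e : rel T) : Prop :=
  exists V : 'I_t.+1 -> {set T},
    [/\ forall i, V i != set0 /\ V i \proper [set: T],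
        forall i j, i != j -> [disjoint V i & V j],
        ~: (\bigcup_i V i) != set0
      & forall i, edge_connectivity e = edges_between e (V i) (~: V i)].

(* No cycle, i.e. no closed walk through at least three distinct vertices. *)
Definition acyclic (F : {set {set T}}) : Prop :=
  forall c : seq T, ucycle (edge_rel F) c -> (size c < 3)%N.

Definition is_forest (e : rel T) (F : {set {set T}}) : Prop :=
  F \subset edges e /\ acyclic F.

Definition is_spanning_tree (e : rel T) (F : {set {set T}}) : Prop :=
  is_forest e F /\ connected_graph (edge_rel F).

Definition component_edges (F : {set {set T}}) (x : T) : {set {set T}} :=
  [set E in F | E \subset [set y | connect (edge_rel F) x y]].

Definition property_P (k d : nat) (e : rel T) : Prop :=
  exists (tree : 'I_k -> {set {set T}}) (F : {set {set T}}),
    [/\ (forall i, is_spanning_tree e (tree i)) /\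
        (forall i j, i != j -> [disjoint tree i & tree j]),
        is_forest e F,
        forall i, [disjoint F & tree i],
        (d%:R - 1) / d%:R * (#|T|%:R - 1) < #|F|%:R :> rat
      & ~ is_spanning_tree e F ->
        exists x : T, (d <= #|component_edges F x|)%N].

End Graphs.

Section Laplacian.

Variables (T : finType) (e : rel T).

Definition adjacency_mx : 'M[algC]_#|T| :=
  \matrix_(i, j) (e (enum_val i) (enum_val j))%:R.

Definition degree_mx : 'M[algC]_#|T| :=
  diag_mx (\row_i (degree e (enum_val i))%:R).

Definition laplacian_mx : 'M[algC]_#|T| := degree_mx - adjacency_mx.

End Laplacian.

(* The roots of the characteristic polynomial, with multiplicity, in
   nonincreasing order. The order of [algC] is only total on the reals, so this
   is meaningful when all the eigenvalues of [A] are real. *)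
Definition eigenvalues n (A : 'M[algC]_n) : seq algC :=
  sort >=%R (sval (closed_field_poly_normal (char_poly A))).

(* The [i]-th largest Laplacian eigenvalue, counting from [i = 1]. *)
Definition mu (T : finType) (e : rel T) (i : nat) : algC :=
  nth 0 (eigenvalues (laplacian_mx e)) i.-1.

Lemma char_poly_eigenvalues n (A : 'M[algC]_n) :
  char_poly A = \prod_(x <- eigenvalues A) ('X - x%:P).
Proof.
rewrite /eigenvalues; case: closed_field_poly_normal => r /= {1}->.
rewrite (monicP (char_poly_monic A)) scale1r.
by apply: perm_big; rewrite perm_sym perm_sort.
Qed.

Lemma size_eigenvalues n (A : 'M[algC]_n) : size (eigenvalues A) = n.
Proof.
have := size_char_poly A.
by rewrite char_poly_eigenvalues size_prod_XsubC => -[].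
Qed.

Lemma laplacian_hermitian (T : finType) (e : rel T) :
  symmetric e -> laplacian_mx e \is hermsymmx.
Proof.
move=> esym; apply/is_hermitianmxP; rewrite expr0 scale1r.
apply/matrixP => i j; rewrite !mxE rmorphB rmorphMn !rmorph_nat eq_sym.
by rewrite (esym (enum_val j)); case: eqP => [->|].
Qed.

Lemma laplacian_eigenvalues_real (T : finType) (e : rel T) :
  symmetric e -> {subset eigenvalues (laplacian_mx e) <= Num.real}.
Proof.
move=> /laplacian_hermitian hA x.
set A := laplacian_mx e in hA *.
rewrite -root_prod_XsubC -char_poly_eigenvalues -eigenvalue_root_char.
case/eigenvalueP => v vA v0.
have /orthomx_spectralP eqA := hermitian_normalmx hA.
pose w := v *m invmx (spectralmx A).
have w0 : w != 0.
  apply: contraNneq v0 => w0.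
  by rewrite -[v](mulmxKV (spectral_unit A)) -/w w0 mul0mx.
have wD : w *m diag_mx (spectral_diag A) = x *: w.
  rewrite -[LHS](mulmxK (spectral_unit A)) /w -!mulmxA.
  by rewrite [diag_mx _ *m _]mulmxA [invmx _ *m (_ *m _)]mulmxA
             [_ *m (diag_mx _ *m _)]mulmxA -eqA mulmxA vA scalemxAl.
have /rV0Pn[j wj] := w0.
have := congr1 (fun M : 'rV_ _ => M 0 j) wD.
rewrite /= mul_mx_diag [LHS]mxE [RHS]mxE mulrC => /(mulIf wj) <-.
exact: (mxOverP (hermitian_spectral_diag_real hA)).
Qed.

Lemma laplacian_eigenvalues_sorted (T : finType) (e : rel T) :
  symmetric e -> sorted >=%R (eigenvalues (laplacian_mx e)).
Proof.
move=> esym; apply: (@sort_sorted_in _ Num.real).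
  by move=> x y xR yR; apply: real_leVge.
apply/allP => x; rewrite -(mem_sort >=%R).
exact: laplacian_eigenvalues_real.
Qed.

(* Main.v *)
Require Import Defs.
From mathcomp Require Import all_boot all_order all_algebra all_field.
From mathcomp Require Import zify ring.

Set Implicit Arguments.
Unset Strict Implicit.
Unset Printing Implicit Defensive.

Import Order.TTheory GRing.Theory Num.Theory.

(** Under these hypotheses the graph even has k+1 edge-disjoint spanning trees,
    so the forest can be taken to be a spanning tree. By the theorem of
    Nash-Williams and Tutte ([tree_packing]) this amounts to showing that every
    partition P of the vertices satisfies

      sum of the cut sizes of the parts >= 2 (k+1) (|P| - 1).

    The eigenvalue hypothesis enters through one consequence. If S_1, ..., S_m
    are disjoint and nonempty, the Laplacian form of a combination of their
    indicator vectors is at most twice the sum of |a_i|^2 cut(S_i), so by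
    Courant-Fischer the m-th smallest eigenvalue is at most the maximum of
    2 cut(S_i) / |S_i| ([mu_disjoint_sets]). Call a set with more than delta
    vertices and cut at most 4k+3 an island. Four disjoint islands would give
    mu_(n-3) <= (8k+6)/(delta+1), which is below the assumed bound; hence there
    are never four disjoint islands ([no_four_islands_mu]). As a nonempty set with at
    most delta vertices has cut at least delta ([small_set_cut]), every nonempty
    set with cut at most 2k+1 is an island.

    Suppose a partition P violates the inequality, and let Q be its parts with
    cut at most 2k+1; these are islands, so |Q| <= 3. Counting gives
    sum_Q cut < 2 (k+1) (|Q| - 1), hence 3 kappa <= 4k+3 for the edge connectivity
    kappa. The sets V_1, V_2, V_3 given by the class have cut kappa, so they are
    islands, and the rest R has cut at most 3 kappa <= 4k+3; not being a fourth
    island, R has at most delta vertices, therefore cut at least delta >= 3k+3,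
    and kappa >= k+1. This forces |Q| = 3 and then P = Q, with total cut at most
    4k+3. By submodularity a nonempty intersection of a part with some V_j is again
    an island, so four disjoint islands are avoided only if each part meets
    exactly one V_j and is otherwise contained in R. A part U that meets R has
    U minus V_j of at most delta vertices, so cut(U) >= delta - kappa, and the
    three cuts add up to at least delta + kappa >= 4k+4 ([three_parts_sum]): a
    contradiction. *)

(** * The closure operator of the graphic matroid *)

Section Closure.

Variable T : finType.
Implicit Types (X Y F : {set {set T}}) (E : {set T}) (x y a b : T).

Local Notation linked X := (connect (edge_rel X)).

(** For a two-element [E] this says that the edge [E] is in the closure of [X] in
    the graphic matroid. *)
Definition spanned X E := [forall x in E, forall y in E, linked X x y].

Lemma spannedP X E :
  reflect {in E &, forall x y, linked X x y} (spanned X E).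
Proof.
apply: (iffP forall_inP) => [H x y xE yE|H x xE].
  exact: (forall_inP (H x xE)).
by apply/forall_inP => y yE; apply: H.
Qed.

Lemma edge_rel_sym X : symmetric (edge_rel X).
Proof. by move=> x y; rewrite /edge_rel /= eq_sym setUC. Qed.

Lemma linked_sym X : connect_sym (edge_rel X).
Proof. exact/sym_connect_sym/edge_rel_sym. Qed.

Lemma spanned2 X a b : spanned X [set a; b] = linked X a b.
Proof.
apply/spannedP/idP => [->//|ab x y]; rewrite ?set21 ?set22 // !inE.
by do 2![case/orP => /eqP ->]; rewrite // linked_sym.
Qed.

Lemma linked_edge X x y : [set x; y] \in X -> linked X x y.
Proof.
by case: (eqVneq x y) => [-> //|xy xyX]; apply: connect1; rewrite /edge_rel /= xy.
Qed.

Lemma spanned_mem X E : #|E| = 2 -> E \in X -> spanned X E.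
Proof.
by move=> /eqP/cards2P[a [b [_ ->]]] abX; rewrite spanned2 linked_edge.
Qed.

Lemma linkedS X Y x y : X \subset Y -> linked X x y -> linked Y x y.
Proof.
move=> sXY; apply: connect_sub => u v /andP[_ uvX].
exact/linked_edge/(subsetP sXY).
Qed.

Lemma spannedS X Y E : X \subset Y -> spanned X E -> spanned Y E.
Proof.
move=> sXY /spannedP XE; apply/spannedP => x y xE yE.
exact/(linkedS sXY)/XE.
Qed.

Lemma linked_span X Y x y :
  {in Y, forall E, spanned X E} -> linked Y x y -> linked X x y.
Proof.
move=> XY; apply: connect_sub => u v /andP[_ /XY].
by rewrite spanned2.
Qed.

Lemma spanned_trans X Y E :
  {in Y, forall E, spanned X E} -> spanned Y E -> spanned X E.
Proof.
move=> XY /spannedP YE; apply/spannedP => x y xE yE.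
exact/(linked_span XY)/YE.
Qed.

(** A path that uses the edge ab splits at its first and last use of it. All the
    matroid properties below rest on this equivalence. *)
Lemma linkedU1 X a b x y :
  linked ([set a; b] |: X) x y =
  [|| linked X x y, linked X x a && linked X b y
    | linked X x b && linked X a y].
Proof.
set Z := _ |: X; have sXZ : X \subset Z by exact: subsetUr.
have abZ : linked Z a b by apply: linked_edge; rewrite setU11.
apply/idP/idP; last first.
  case/or3P => [|/andP[xa yb]|/andP[xb ya]]; first exact: linkedS.
    apply: connect_trans (linkedS sXZ xa) _.
    exact: connect_trans abZ (linkedS sXZ yb).
  apply: connect_trans (linkedS sXZ xb) _; rewrite linked_sym in abZ.
  exact: connect_trans abZ (linkedS sXZ ya).
case/connectP => p; elim: p x => [x _ -> /=|z p IHp x /=].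
  by rewrite connect0.
case/andP => /andP[xz]; rewrite in_setU1 => /orP[/eqP xzab|xzX] pP lP.
  have {}IHp := IHp _ pP lP.
  have: x \in [set a; b] by rewrite -xzab set21.
  have: z \in [set a; b] by rewrite -xzab set22.
  rewrite !inE => /orP[]/eqP ? /orP[]/eqP ?; subst x z; rewrite ?eqxx // in xz *;
  by case/or3P: IHp => [H|/andP[_ H]|/andP[H1 H]]; rewrite ?connect0 ?H ?orbT.
have xzl := linked_edge xzX.
by rewrite !(same_connect (@linked_sym X) xzl); apply: IHp.
Qed.

(** The Mac Lane-Steinitz exchange property of the closure. *)
Lemma spanned_exchange X E E' :
  #|E| = 2 -> #|E'| = 2 ->
  spanned (E |: X) E' -> ~~ spanned X E' -> spanned (E' |: X) E.
Proof.
move=> /eqP/cards2P[a [b [_ ->]]] /eqP/cards2P[c [d [_ ->]]].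
rewrite !spanned2 !linkedU1 => /or3P[-> //|/andP[ca bd]|/andP[cb ad]] _.
  by rewrite (linked_sym X a c) ca (linked_sym X d b) bd orbT.
by rewrite ad cb !orbT.
Qed.

(** Every edge is a bridge. Compared with the absence of cycles, this form is
    stated with the closure alone, which is all that exchanges require. *)
Definition independent F := [forall E in F, ~~ spanned (F :\ E) E].

Lemma independentP F :
  reflect {in F, forall E, ~~ spanned (F :\ E) E} (independent F).
Proof. exact: forall_inP. Qed.

Lemma independentS F X : X \subset F -> independent F -> independent X.
Proof.
move=> sXF /independentP indF; apply/independentP => E EX.
by apply: contra (indF E (subsetP sXF E EX)); apply/spannedS/setSD.
Qed.

Lemma independent0 : independent set0.
Proof. by apply/independentP => E; rewrite inE. Qed.

Lemma independentU1 F E :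
    {in F, forall E', #|E'| = 2} -> #|E| = 2 ->
  independent F -> ~~ spanned F E -> independent (E |: F).
Proof.
move=> F2 E2 indF nFE; apply/independentP => E'.
rewrite in_setU1; case: eqVneq => [-> _|neE /= E'F].
  by apply: contra nFE; apply: spannedS; rewrite subDset subxx.
have E'2 := F2 _ E'F.
apply: contra nFE => E'sp.
have defEF : (E |: F) :\ E' = E |: (F :\ E').
  by apply/setP => D; rewrite !inE; case: eqVneq => // ->; rewrite (negPf neE).
have := @spanned_exchange (F :\ E') E E' E2 E'2.
rewrite -defEF setD1K // => -> //.
exact: (independentP F indF).
Qed.

(** The spanning set is the fundamental circuit of [E] without [E] itself: the
    edges of [F] that can be traded for [E]. A minimal subset C of [F] spanning
    [E] is contained in it: if E' in C could not be traded, [E] would be spanned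
    by [F] without E', and by exchange so would E', against independence. *)
Lemma spanned_circuit F E :
    {in F, forall E', #|E'| = 2} -> #|E| = 2 ->
    independent F -> spanned F E ->
  spanned [set E' in F | ~~ spanned (F :\ E') E] E.
Proof.
move=> F2 E2 indF FE.
pose P X := (X \subset F) && spanned X E.
have PF : P F by rewrite /P subxx.
have [C /minsetP[/andP[sCF CE] minC] _] := minset_exists PF.
apply: (spannedS _ CE); apply/subsetP => E' E'C; have E'F := subsetP sCF _ E'C.
rewrite inE E'F; apply/negP => FE'E.
have nC : ~~ spanned (C :\ E') E.
  apply/negP => CE'; have sC : C :\ E' \subset C by exact: subsetDl.
  have := minC (C :\ E'); rewrite /P CE' (subset_trans sC sCF) => /(_ isT sC) eqC.
  by move: E'C; rewrite -eqC setD11.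
case/negP: (independentP F indF E' E'F).
have sp : spanned (E |: (C :\ E')) E'.
  by apply: spanned_exchange => //; [exact: F2|rewrite setD1K].
apply: spanned_trans sp => D; rewrite in_setU1 => /orP[/eqP-> //|DC].
have DF : D \in F :\ E' by apply: subsetP DC; exact: setSD.
by apply: spanned_mem => //; apply: F2; case/setD1P: DF.
Qed.

End Closure.

(** * Connected components and the rank of a forest *)

Section Components.

Variable T : finType.
Implicit Types (X Y F : {set {set T}}) (E : {set T}) (x y a b : T).

Local Notation linked X := (connect (edge_rel X)).

Definition component X x := [set y | linked X x y].

Definition components X := [set component X x | x in [set: T]].

Lemma component_eq X x y : (component X x == component X y) = linked X x y.
Proof.
apply/eqP/idP => [eqC|xy].
  by have: y \in component X y by [rewrite inE]; rewrite -eqC inE.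
by apply/setP => z; rewrite !inE (same_connect (@linked_sym T X) xy).
Qed.

Lemma mem_components X x : component X x \in components X.
Proof. by apply/imsetP; exists x. Qed.

Lemma components_partition X : partition (components X) [set: T].
Proof.
have -> : components X = equivalence_partition (linked X) [set: T].
  by apply: eq_imset => x; apply/setP => y; rewrite !inE.
apply: equivalence_partitionP => x y z _ _ _; split=> // xy.
exact: same_connect (@linked_sym T X) _ _ xy z.
Qed.

Lemma components0 : #|components set0| = #|T|.
Proof.
rewrite card_imset ?cardsT // => x y /eqP; rewrite component_eq.
case/connectP => -[|z p] /=; first by move=> _ ->.
by rewrite /edge_rel /= inE andbF.
Qed.

(** The components of [a] and [b] merge and all the others are unchanged. *)
Lemma card_componentsU1 X a b :
  ~~ linked X a b ->
  #|components X| = #|components ([set a; b] |: X)|.+1.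
Proof.
move=> nab; set Z := _ |: X.
pose Ca := component X a; pose Cb := component X b.
have linkX := @linked_sym T X.
have compZ x : component Z x =
    if linked X x a || linked X x b then Ca :|: Cb else component X x.
  apply/setP => y; rewrite inE linkedU1; case: ifP => [|/norP[/negPf-> /negPf->]].
    case/orP => xl; rewrite !inE.
      rewrite xl !(same_connect linkX xl) (negPf nab) /=.
      by rewrite orbF.
    rewrite xl !(same_connect linkX xl) (linkX b a) (negPf nab) /=.
    by rewrite orbC.
  by rewrite inE orbF.
have defZ : components Z = (Ca :|: Cb) |: (components X :\ Ca :\ Cb).
  apply/setP => K; apply/imsetP/setU1P => [[x _ ->]|].
    rewrite compZ; case: ifP => [_|/norP[xa xb]]; [by left|right].
    by rewrite !inE !component_eq xa xb mem_components.
  case=> [->|]; first by exists a; rewrite // compZ connect0.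
  case/setD1P => nKb /setD1P[nKa /imsetP[x _ eK]]; exists x => //.
  by move: nKa nKb; rewrite eK !component_eq compZ => /negPf-> /negPf->.
have nCab : Ca :|: Cb \notin components X.
  apply/imsetP => -[z _ eqC].
  have: a \in component X z by rewrite -eqC !inE connect0.
  have: b \in component X z by rewrite -eqC !inE connect0 orbT.
  rewrite !inE => zb za; case/negP: nab.
  by apply: connect_trans zb; rewrite linkX.
rewrite defZ cardsU1 !inE (negPf nCab) !andbF /= (cardsD1 Ca) mem_components.
rewrite (cardsD1 Cb (_ :\ Ca)) !inE mem_components component_eq.
by rewrite linkX nab.
Qed.

Lemma card_independent F :
    {in F, forall E, #|E| = 2} -> independent F ->
  #|F| + #|components F| = #|T|.
Proof.
have [m] := ubnP #|F|; elim: m F => // m IHm F leFm F2 indF.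
have [->|[E EF]] := set_0Vmem F; first by rewrite cards0 components0.
have /eqP/cards2P[a [b [_ eE]]] := F2 E EF.
have indFE := independentS (subsetDl F [set E]) indF.
have cF : #|F| = #|F :\ E|.+1 by rewrite (cardsD1 E) EF.
have nab : ~~ linked (F :\ E) a b by rewrite -spanned2 -eE (independentP F indF).
rewrite -(IHm (F :\ E)) //; first 1 last.
- by rewrite -ltnS -cF.
- by move=> D /setD1P[_ /F2].
by rewrite (card_componentsU1 nab) -eE setD1K // cF addSnnS.
Qed.

(** The rest of a cycle bypasses the edge between its first two vertices. *)
Lemma independent_acyclic F : independent F -> acyclic F.
Proof.
move=> indF [|x [|y [|z p]]] // /andP[cyc Uc].
have /= /andP[xy] := cyc; rewrite rcons_path => /and3P[yz zp lx].
have /= /and3P[xN yN _] := Uc.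
have xyF : [set x; y] \in F by case/andP: xy.
case/negP: (independentP F indF _ xyF).
set l := last z p in lx.
have lN : l != y by apply: contraNneq yN => <-; apply: mem_last.
have xl : x != l by apply: contraNneq xN => ->; rewrite inE mem_last orbT.
rewrite spanned2; apply: (@connect_trans _ _ l).
  rewrite linked_sym; apply: connect1; case/andP: lx => lx lxF.
  rewrite /edge_rel /= lx !inE lxF andbT.
  apply: contra_neq lN => eqlx; have: l \in [set x; y] by rewrite -eqlx set21.
  by rewrite !inE eq_sym (negPf xl) => /eqP.
rewrite linked_sym; apply/connectP; exists (z :: p) => //.
apply: (@sub_in_path _ (predC1 x) (edge_rel F)); first 1 last.
- by apply/allP => u; apply: contraTneq => ->.
- by rewrite /= yz.
move=> u v; rewrite !inE => ux vx /andP[uv uvF].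
rewrite /edge_rel /= uv !inE uvF andbT.
apply: contra_neq ux => uvE; have: x \in [set u; v] by rewrite uvE set21.
by rewrite !inE eq_sym [x == v]eq_sym (negPf vx) orbF => /eqP.
Qed.

End Components.

(** * Packing spanning trees *)

Section Packing.

Variables (T : finType) (e : rel T) (k : nat).
Hypothesis e_irr : irreflexive e.
Implicit Types (E : {set T}) (i : 'I_k).

Lemma card_edge E : E \in edges e -> #|E| = 2.
Proof.
case/imset2P => x y _; rewrite inE => /andP[_ exy] ->; rewrite cards2.
by case: eqVneq exy => // ->; rewrite e_irr.
Qed.

(** Color [i] stands for the [i]-th forest and [None] for an edge that is not
    covered; encoding a family of forests this way makes them disjoint. *)
Definition coloring := {ffun {set T} -> option 'I_k}.
Implicit Types c : coloring.

Definition color_class c i := [set E | c E == Some i].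

Definition covered c := [set E | c E != None].

Definition proper_coloring c :=
  (covered c \subset edges e) && [forall i, independent (color_class c i)].

Definition recolor c E E' i : coloring :=
  [ffun D => if D == E then Some i else if D == E' then None else c D].

(** The uncovered edge [E] replaces [E'] in the forest of color [i]; the third
    condition ensures that the result is a forest again. *)
Definition exchange : rel coloring := [rel c c' : coloring |
  [exists E in edges e, exists E', exists i,
    [&& c E == None, c E' == Some i, ~~ spanned (color_class c i :\ E') E
      & c' == recolor c E E' i]]].

Lemma exchangeP c c' :
  reflect (exists E E' i, [/\ E \in edges e, c E = None, c E' = Some i,
             ~~ spanned (color_class c i :\ E') E & c' = recolor c E E' i])
          (exchange c c').
Proof.
apply: (iffP exists_inP) => [[E Ee /existsP[E' /existsP[i]]]|].
  by case/and4P => /eqP ? /eqP ? ? /eqP ?; exists E, E', i.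
case=> E [E' [i [Ee cE cE' nsp ->]]]; exists E => //.
by apply/existsP; exists E'; apply/existsP; exists i; rewrite cE cE' nsp !eqxx.
Qed.

Lemma in_class c i E : (E \in color_class c i) = (c E == Some i).
Proof. by rewrite inE. Qed.

Lemma in_covered c E : (E \in covered c) = (c E != None).
Proof. by rewrite inE. Qed.

Lemma class_covered c i : color_class c i \subset covered c.
Proof. by apply/subsetP => E; rewrite !inE => /eqP->. Qed.

Lemma class_recolor c E E' i j :
    c E = None -> c E' = Some i ->
  color_class (recolor c E E' i) j =
    if j == i then E |: (color_class c i :\ E') else color_class c j.
Proof.
move=> cE cE'; apply/setP => D; rewrite !inE ffunE.
have [->|neD] := eqVneq D E.
  rewrite (inj_eq Some_inj) (eq_sym i); case: eqP => _.
    by rewrite setU11.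
  by rewrite in_class cE.
have [->|neD'] := eqVneq D E'.
  case: (eqVneq j i) => [->|neji]; last first.
    by rewrite in_class cE' (inj_eq Some_inj) (eq_sym i) (negPf neji).
  rewrite in_setU1 setD11 orbF; apply/esym/negP => /eqP eqE.
  by rewrite -eqE cE' in cE.
by case: (j =P i) => [->|_]; rewrite ?in_setU1 ?in_setD1 in_class // (negPf neD) neD'.
Qed.

Lemma class2 c i : proper_coloring c -> {in color_class c i, forall E, #|E| = 2}.
Proof.
case/andP => sce _ E Ec; apply/card_edge/(subsetP sce).
exact: subsetP (class_covered c i) E Ec.
Qed.

Lemma class_independent c i : proper_coloring c -> independent (color_class c i).
Proof. by case/andP => _ /forallP. Qed.

Lemma exchange_proper c c' :
  exchange c c' -> proper_coloring c ->
  proper_coloring c' /\ #|covered c'| = #|covered c|.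
Proof.
case/exchangeP => E [E' [i [Ee cE cE' nsp ->]]] pc.
have [sce _] := andP pc.
have covE : covered (recolor c E E' i) = E |: (covered c :\ E').
  apply/setP => D; rewrite in_setU1 in_setD1 !in_covered ffunE.
  by case: (D =P E) => //; case: (D =P E').
split; last first.
  rewrite covE cardsU1 in_setD1 in_covered cE eqxx andbF.
  by rewrite (cardsD1 E' (covered c)) in_covered cE'.
apply/andP; split.
  rewrite covE subUset sub1set Ee /=; apply: subset_trans sce; exact: subsetDl.
apply/forallP => j; rewrite class_recolor //; case: eqP => _; last first.
  exact: class_independent.
apply: independentU1 => //.
- by move=> D /setD1P[_]; apply: class2.
- exact: card_edge.
exact: independentS (subsetDl _ _) (class_independent i pc).
Qed.

Lemma reach_proper c c' :
  connect exchange c c' -> proper_coloring c ->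
  proper_coloring c' /\ #|covered c'| = #|covered c|.
Proof.
case/connectP => p; elim: p c => [|c1 p IHp] c /=; first by move=> _ ->.
case/andP => cc1 c1p lp pc; have [pc1 <-] := exchange_proper cc1 pc.
exact: IHp.
Qed.

Definition maximal_coloring c := proper_coloring c /\
  forall c', proper_coloring c' -> #|covered c'| <= #|covered c|.

(** Otherwise [E] could be added to the forest of color [i]. *)
Lemma maximal_spanned c E i :
  maximal_coloring c -> E \in edges e -> c E = None -> spanned (color_class c i) E.
Proof.
move=> [pc maxc] Ee cE; apply/negPn/negP => nsp.
pose c' : coloring := [ffun D => if D == E then Some i else c D].
have covE : covered c' = E |: covered c.
  by apply/setP => D; rewrite in_setU1 !in_covered ffunE; case: (D =P E).
have clE j : color_class c' j =
    if j == i then E |: color_class c i else color_class c j.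
  apply/setP => D; rewrite in_class ffunE; case: (eqVneq D E) => [->|neD].
    rewrite (inj_eq Some_inj) (eq_sym i).
    by case: eqP => _; rewrite ?setU11 // in_class cE.
  by case: (j =P i) => [->|_]; rewrite ?in_setU1 !in_class ?(negPf neD).
have := maxc c'; rewrite covE cardsU1 inE cE eqxx /= add1n ltnn => /(_ _)/notF; apply.
have [sce _] := andP pc; apply/andP; split; first by rewrite covE subUset sub1set Ee.
apply/forallP => j; rewrite clE; case: eqP => _; last exact: class_independent.
apply: independentU1 => //; [exact: class2|exact: card_edge|exact: class_independent].
Qed.

(** This is the set where the packing is tight: below, every forest of a maximal
    coloring [c] is shown to span [freeable c] using only edges inside it. *)
Definition freeable c :=
  [set E in edges e | [exists c', connect exchange c c' && (c' E == None)]].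

Lemma freeableP c E :
  reflect (exists c', [/\ E \in edges e, connect exchange c c' & c' E = None])
          (E \in freeable c).
Proof.
rewrite inE; apply: (iffP andP) => [[Ee /existsP[c' /andP[cc' /eqP c'E]]]|].
  by exists c'.
case=> c' [Ee cc' c'E]; split=> //; apply/existsP; exists c'.
by rewrite cc' c'E /=.
Qed.

Lemma reach_maximal c c' :
  connect exchange c c' -> maximal_coloring c -> maximal_coloring c'.
Proof.
move=> cc' [pc maxc]; have [pc' eqc] := reach_proper cc' pc.
by split=> // c2 /maxc; rewrite eqc.
Qed.

(** Each edge of the fundamental circuit of [E] in [color_class c' i] can be
    traded for [E], which leaves that edge uncovered; so the whole circuit lies
    in [freeable c]. *)
Lemma uncovered_spanned c c' E i :
    maximal_coloring c -> connect exchange c c' ->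
    E \in edges e -> c' E = None ->
  spanned (color_class c' i :&: freeable c) E.
Proof.
move=> maxc cc' Ee c'E; have maxc' := reach_maximal cc' maxc.
have [pc' _] := maxc'; have clE := maximal_spanned i maxc' Ee c'E.
have indc' := class_independent i pc'.
apply: spannedS (spanned_circuit (class2 pc') (card_edge Ee) indc' clE).
apply/subsetP => E' /setIdP[E'c nsp]; rewrite inE E'c; apply/freeableP.
have c'E' : c' E' = Some i by move: E'c; rewrite inE => /eqP.
have neE : E' != E by apply/eqP => eqE; rewrite eqE c'E in c'E'.
exists (recolor c' E E' i); split.
- have [sce _] := andP pc'; apply: (subsetP sce).
  exact: (subsetP (class_covered c' i)).
- by apply: connect_trans cc' _; apply/connect1/exchangeP; exists E, E', i.
by rewrite ffunE (negPf neE) eqxx.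
Qed.

(** By induction on the number of exchanges: the one edge that an exchange brings
    into a color class is spanned by the freeable part of that class just before,
    by [uncovered_spanned]. *)
Lemma reach_class_spanned c c' i :
    maximal_coloring c -> connect exchange c c' ->
  {in color_class c' i :&: freeable c,
    forall E, spanned (color_class c i :&: freeable c) E}.
Proof.
move=> maxc; set A := freeable c; case/connectP => p.
elim/last_ind: p c' => [|p c2 IHp] c' /=.
  move=> _ -> E EcA; apply: spanned_mem => //.
  by case/setIP: EcA => _ /setIdP[/card_edge].
rewrite rcons_path last_rcons => /andP[pp c12] ->.
set c1 := last c p in c12.
have cc1 : connect exchange c c1 by apply/connectP; exists p.
have {}IHp := IHp c1 pp erefl.
case/exchangeP: c12 => E [E' [j [Ee c1E c1E' nsp ->]]].
move=> D /setIP[]; rewrite class_recolor //.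
case: (i =P j) => [eij|_] DC DA; last by apply: IHp; apply/setIP.
subst j; case/setU1P: DC => [->|/setD1P[_ DC]]; last by apply: IHp; apply/setIP.
exact: (spanned_trans IHp (uncovered_spanned i maxc cc1 Ee c1E)).
Qed.

Lemma freeable_spanned c E i :
  maximal_coloring c -> E \in freeable c -> spanned (color_class c i :&: freeable c) E.
Proof.
move=> maxc /freeableP[c' [Ee cc' c'E]].
apply: (spanned_trans (reach_class_spanned maxc cc')).
exact: uncovered_spanned.
Qed.

Lemma maximal_coloring_exists : exists c, maximal_coloring c.
Proof.
pose c0 : coloring := [ffun => None].
have pc0 : proper_coloring c0.
  have cov0 : covered c0 = set0 by apply/setP => E; rewrite !inE ffunE.
  apply/andP; split; first by rewrite cov0 sub0set.
  apply/forallP => i; have := class_covered c0 i; rewrite cov0 subset0 => /eqP->.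
  exact: independent0.
case: (arg_maxnP (fun c => #|covered c|) pc0) => c pc maxc.
by exists c; split.
Qed.

Lemma card_coveredI c (B : {set {set T}}) :
  #|covered c :&: B| = \sum_i #|color_class c i :&: B|.
Proof.
have cardI (X : {set {set T}}) : #|X :&: B| = \sum_(E in B) (E \in X).
  rewrite -sum1_card big_mkcond [RHS]big_mkcond; apply: eq_bigr => E _.
  by rewrite inE andbC; do 2!case: (_ \in _).
rewrite cardI (eq_bigr _ (fun i _ => cardI (color_class c i))) exchange_big.
apply: eq_bigr => E _; rewrite in_covered.
case cE: (c E) => [j|]; last first.
  by rewrite big1 // => i _; rewrite in_class cE.
rewrite (bigD1 j) //= in_class cE eqxx big1 // => i neij.
by rewrite in_class cE (inj_eq Some_inj) eq_sym (negPf neij).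
Qed.

Definition crossing (P : {set {set T}}) :=
  [set E in edges e | ~~ [exists S in P, E \subset S]].

(** The theorem of Nash-Williams and Tutte. Take a maximal coloring, let A be its
    set of freeable edges and P the components of A. Each forest has |T| - |P|
    edges in A, since it spans A there, and all edges outside A are covered. No
    edge of A crosses P, so at least k (|T| - |P|) + k (|P| - 1) = k (|T| - 1)
    edges are covered, which is possible only if all the forests are spanning
    trees. *)
Theorem tree_packing : 0 < #|T| ->
    (forall P, partition P [set: T] -> k * #|P|.-1 <= #|crossing P|) ->
  exists tree : 'I_k -> {set {set T}},
    [/\ forall i, is_spanning_tree e (tree i),
        forall i, #|tree i| = #|T|.-1
      & forall i j, i != j -> [disjoint tree i & tree j]].
Proof.
move=> T_gt0 crossP; have [c maxc] := maximal_coloring_exists.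
have [pc _] := maxc; have [sce _] := andP pc.
set A := freeable c; pose P := components A.
have cardA i : #|color_class c i :&: A| + #|P| = #|T|.
  have c2 : {in color_class c i :&: A, forall E, #|E| = 2}.
    by move=> E /setIP[/class2->].
  rewrite -(card_independent c2); last first.
    exact: independentS (subsetIl _ _) (class_independent i pc).
  congr (_ + #|pred_of_set _|); apply: eq_imset => x; apply/setP => y; rewrite !inE.
  apply/idP/idP; last exact/linkedS/subsetIr.
  by apply: linked_span => E; apply: freeable_spanned.
have P_gt0 : 0 < #|P|.
  have /card_gt0P[x _] := T_gt0.
  by apply/card_gt0P; exists (component A x); apply: mem_components.
have sEAc : edges e :\: A \subset covered c :\: A.
  apply/subsetP => E /setDP[Ee EA]; apply/setDP; split=> //.
  rewrite in_covered; apply: contra EA => /eqP cE; apply/freeableP.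
  by exists c; split=> //; apply: connect0.
have crossA : crossing P \subset edges e :\: A.
  apply/subsetP => E /setIdP[Ee nP]; apply/setDP; split=> //.
  apply: contra nP => EA; have /eqP/cards2P[x [y [_ eE]]] := card_edge Ee.
  apply/exists_inP; exists (component A x); first exact: mem_components.
  rewrite eE in EA *; apply/subsetP => z; rewrite !inE.
  by case/orP => /eqP->; rewrite ?connect0 // linked_edge.
have cov_ge : k * #|T|.-1 <= \sum_i #|color_class c i|.
  have <- : #|covered c| = \sum_i #|color_class c i|.
    by rewrite -[covered c]setIT card_coveredI; apply: eq_bigr => i _; rewrite setIT.
  rewrite -(cardsID A) card_coveredI.
  rewrite (eq_bigr (fun _ => #|T| - #|P|)); last first.
    by move=> i _; rewrite -(cardA i) addnK.
  rewrite sum_nat_const card_ord.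
  have := leq_trans (crossP P (components_partition A)) (subset_leq_card crossA).
  move=> /leq_trans/(_ (subset_leq_card sEAc)).
  move=> /(leq_add (leqnn (k * (#|T| - #|P|)))); apply: leq_trans.
  by rewrite -mulnDr leq_mul2l; apply/orP; right; move: #|T| #|P| => t p; lia.
have cardC i : #|color_class c i| + #|components (color_class c i)| = #|T|.
  exact: card_independent (@class2 c i pc) (class_independent i pc).
have comp_gt0 i : 0 < #|components (color_class c i)|.
  have /card_gt0P[x _] := T_gt0.
  by apply/card_gt0P; exists (component (color_class c i) x); apply: mem_components.
have /leqif_sum : forall i : 'I_k, true ->
    #|color_class c i| <= #|T|.-1 ?= iff (#|color_class c i| == #|T|.-1).
  by move=> i _; apply/leqif_eq; have := cardC i; have := comp_gt0 i; lia.
rewrite sum_nat_const card_ord => /geq_leqif; rewrite cov_ge => /esym/forallP allT.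
exists (color_class c); split=> [i|i|i j neij]; last first.
- rewrite -setI_eq0; apply/eqP/setP => E; rewrite in_setI !in_class inE.
  by apply/negP => /andP[/eqP-> /eqP[eij]]; rewrite eij eqxx in neij.
- exact/eqP/(allT i).
split; first split.
- exact: subset_trans (class_covered c i) sce.
- exact/independent_acyclic/class_independent.
have /eqP cT := allT i.
have /eqP/cards1P[K eK] : #|components (color_class c i)| = 1.
  by have := cardC i; have := cT; have := T_gt0; lia.
apply/forallP => x; apply/forallP => y; rewrite -component_eq.
have := mem_components (color_class c i) x; have := mem_components (color_class c i) y.
by rewrite eK !inE => /eqP-> /eqP->.
Qed.

End Packing.

(** * Cuts *)

Section Cuts.

Variables (T : finType) (e : rel T).
Hypotheses (e_sym : symmetric e) (e_irr : irreflexive e).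
Implicit Types (S A B : {set T}) (P Q : {set {set T}}) (x y : T).

(** The sum runs over ordered pairs, one from each edge leaving [S], so that
    inequalities between cuts can be checked pair by pair. *)
Definition cut S := \sum_(p : T * T | e p.1 p.2) ((p.1 \in S) && (p.2 \notin S)).

Lemma cut_sum S : cut S = \sum_(x in S) #|[set y | e x y] :\: S|.
Proof.
rewrite (eq_bigr (fun x => \sum_(y | e x y) (y \notin S))); last first.
  move=> x _; rewrite -sum1_card big_mkcond [RHS]big_mkcond; apply: eq_bigr => y _.
  by rewrite !inE; case: (e x y); case: (y \in S).
rewrite big_mkcond.
rewrite (eq_bigr (fun x => \sum_(y | e x y) ((x \in S) && (y \notin S)))); last first.
  by move=> x _; case: (x \in S) => //=; rewrite big1.
by rewrite pair_big_dep.
Qed.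

Lemma cutC S : cut (~: S) = cut S.
Proof.
pose swap (p : T * T) := (p.2, p.1).
have swapK : involutive swap by case.
rewrite /cut (reindex_inj (inv_inj swapK)); apply: eq_big => p /=.
  exact: e_sym.
by rewrite !inE negbK andbC.
Qed.

Lemma cut_submodular A B : cut (A :&: B) + cut (A :|: B) <= cut A + cut B.
Proof.
rewrite /cut -!big_split; apply: leq_sum => -[x y] /= _; rewrite !inE.
by do 4!case: (_ \in _).
Qed.

Lemma cutU A B : cut (A :|: B) <= cut A + cut B.
Proof. by apply: leq_trans (cut_submodular A B); apply: leq_addl. Qed.

Lemma cut_bigcup (I : finType) (R : {pred I}) (F : I -> {set T}) :
  cut (\bigcup_(i in R) F i) <= \sum_(i in R) cut (F i).
Proof.
elim/big_rec2: _ => [|i n A _ leAn]; first by rewrite /cut big1 // => p; rewrite inE.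
by apply: leq_trans (cutU _ _) _; rewrite leq_add2l.
Qed.

Lemma cut_between S : edges_between e S (~: S) = cut S.
Proof.
pose arcs := [set p : T * T | [&& e p.1 p.2, p.1 \in S & p.2 \notin S]].
have -> : cut S = #|arcs|.
  rewrite -sum1_card /cut big_mkcond [RHS]big_mkcond; apply: eq_bigr => p _.
  by rewrite inE; case: (e _ _) => //=; case: (_ && _).
rewrite -(card_in_imset (f := fun p : T * T => [set p.1; p.2]) (D := mem arcs)).
  apply: eq_card => E; apply/imset2P/imsetP => [[x y xS]|[[x y]]].
    rewrite !inE => /andP[yS exy] ->; exists (x, y) => //.
    by rewrite !inE exy xS.
  rewrite inE /= => /and3P[exy xS yS] ->; exists x y => //.
  by rewrite !inE exy yS.
move=> [x y] [u v]; rewrite !inE /= => /and3P[_ xS yS] /and3P[_ uS vS] eqE.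
have : u \in [set x; y] by rewrite eqE set21.
have : v \in [set x; y] by rewrite eqE set22.
rewrite !inE => /orP[]/eqP ev /orP[]/eqP eu; subst u v => //.
- by rewrite xS in vS.
- by rewrite xS in vS.
by rewrite uS in yS.
Qed.

Lemma bigminn_leq (I : finType) (R : pred I) (F : I -> nat) m i :
  R i -> \big[minn/m]_(j | R j) F j <= F i.
Proof.
move=> Ri; have := mem_index_enum i; elim: index_enum => // j r IHr.
rewrite in_cons big_cons => /orP[/eqP <-|ir]; first by rewrite Ri geq_minl.
by case: ifP => _; rewrite ?IHr // geq_min IHr ?orbT.
Qed.

Lemma min_degree_leq x : min_degree e <= degree e x.
Proof. exact: bigminn_leq. Qed.

Lemma edge_connectivity_leq S :
  S != set0 -> S \proper [set: T] -> edge_connectivity e <= cut S.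
Proof.
case/set0Pn => x xS; rewrite properT -subTset => /subsetPn[y _ yS].
rewrite -cut_between; apply: bigminn_leq; apply/andP; split.
  apply/subsetP => E /imset2P[u v _]; rewrite inE => /andP[_ euv] ->.
  by apply/imset2P; exists u v; rewrite // inE.
apply/forallPn; exists x; apply/forallPn; exists y.
set r := edge_rel _; apply/negP => xy.
have clS : closed r (mem S).
  apply: (intro_closed (@linked_sym T _)) => u v /andP[_].
  rewrite !inE => /andP[nb /imset2P[a b _]]; rewrite inE => /andP[_ eab] euv uS.
  apply: contraNT nb => vS; apply/imset2P; exists u v => //.
  have {}uS : u \in S := uS; have {}vS : v \notin S := vS.
  rewrite !inE vS /=.
  have : u \in [set a; b] by rewrite -euv set21.
  have : v \in [set a; b] by rewrite -euv set22.
  rewrite !inE => /orP[]/eqP ev /orP[]/eqP eu; subst u v => //.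
  - by rewrite uS in vS.
  - by rewrite e_sym.
  - by rewrite uS in vS.
have eqS : (x \in S) = (y \in S) := closed_connect clS xy.
by rewrite xS (negPf yS) in eqS.
Qed.

(** Each vertex of [S] has at least d - (|S| - 1) neighbors outside [S], and
    s (d - s + 1) >= d for 1 <= s <= d. *)
Lemma small_set_cut S : S != set0 -> #|S| <= min_degree e -> min_degree e <= cut S.
Proof.
rewrite -card_gt0 => S0 leSd; rewrite cut_sum.
have bound x : x \in S -> min_degree e - #|S|.-1 <= #|[set y | e x y] :\: S|.
  move=> xS; rewrite leq_subLR; apply: leq_trans (min_degree_leq x) _.
  rewrite /degree -(cardsID S) leq_add2r.
  have -> : #|S|.-1 = #|S :\ x| by rewrite (cardsD1 x S) xS.
  apply/subset_leq_card/subsetP => y; rewrite !inE => /andP[exy ->].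
  by rewrite andbT; apply: contraTneq exy => ->; rewrite e_irr.
apply: leq_trans (_ : \sum_(x in S) (min_degree e - #|S|.-1) <= _); last first.
  exact: leq_sum.
rewrite sum_nat_const.
move: (min_degree e) #|S| S0 leSd {bound} => d s; nia.
Qed.

Lemma cut_gt_card S : S != set0 -> cut S < min_degree e -> min_degree e < #|S|.
Proof. by move=> S0; rewrite !ltnNge; apply: contra => /small_set_cut->. Qed.

(** An edge can leave only the two parts that contain its ends, and an edge
    leaving some part is crossing. *)
Lemma sum_cut_crossing P :
  partition P [set: T] -> \sum_(S in P) cut S <= 2 * #|crossing e P|.
Proof.
case/and3P => /eqP covP tP _.
pose bd S := [set [set x; y] | x in S, y in ~: S & e x y].
have cutbd S : S \in P -> cut S = \sum_(E in crossing e P) (E \in bd S).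
  move=> SP; rewrite -cut_between -[edges_between _ _ _]/#|bd S|.
  rewrite -sum1_card big_mkcond [RHS]big_mkcond; apply: eq_bigr => E _.
  case: ifP => [Ebd|nEbd]; last by case: ifP.
  rewrite ifT //; have [x y xS] := imset2P Ebd; rewrite !inE => /andP[yS exy] eE.
  rewrite eE; apply/andP; split; first by apply/imset2P; exists x y; rewrite // inE.
  apply/exists_inP => -[S' S'P sES'].
  have xS' : x \in S' by rewrite (subsetP sES') ?set21.
  have yS' : y \in S' by rewrite (subsetP sES') ?set22.
  by rewrite -(def_pblock tP SP xS) (def_pblock tP S'P xS') yS' in yS.
rewrite (eq_bigr _ cutbd) exchange_big /= mulnC -sum_nat_const.
apply: leq_sum => E /setIdP[/imset2P[x y _]]; rewrite inE => /andP[_ exy] eE _.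
apply: leq_trans (_ : #|[set pblock P x; pblock P y]| <= 2); last first.
  by rewrite cards2; case: eqP.
rewrite -sum1_card big_mkcond [X in _ <= X]big_mkcond; apply: leq_sum => S _.
case: ifP => // SP; case: (boolP (E \in bd S)) => // /imset2P[u v uS _ eE'].
rewrite ifT // -(def_pblock tP SP uS).
have : u \in [set x; y] by rewrite -eE eE' set21.
by rewrite !inE => /orP[]/eqP->; rewrite eqxx ?orbT.
Qed.

End Cuts.

(** * The spectral theorem and a half of Courant-Fischer *)

Section Spectral.

Local Open Scope ring_scope.
Local Open Scope sesquilinear_scope.

Lemma char_poly_similar (R : comUnitRingType) n (P A : 'M[R]_n) :
  P \in unitmx -> char_poly (invmx P *m A *m P) = char_poly A.
Proof.
move=> Pu; rewrite /char_poly /char_poly_mx.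
have VP : map_mx polyC (invmx P) *m map_mx polyC P = 1%:M.
  by rewrite -map_mxM mulVmx // map_mx1.
have -> : 'X%:M - map_mx polyC (invmx P *m A *m P) =
    map_mx polyC (invmx P) *m ('X%:M - map_mx polyC A) *m map_mx polyC P.
  by rewrite mulmxBr mulmxBl !map_mxM scalar_mxC -(mulmxA 'X%:M) VP mulmx1.
by rewrite !det_mulmx mulrAC -det_mulmx VP det1 mul1r.
Qed.

Lemma eigenvalues_spectral n (A : 'M[algC]_n) : A \is normalmx ->
  perm_eq (eigenvalues A) [seq spectral_diag A 0 j | j <- enum 'I_n].
Proof.
move=> /orthomx_spectralP eqA; apply: prod_XsubC_eq.
rewrite -char_poly_eigenvalues [in LHS]eqA char_poly_similar ?spectral_unit //.
rewrite char_poly_trig ?diag_mx_is_trig // big_map big_enum.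
by apply: eq_bigr => j _; rewrite mxE eqxx mulr1n.
Qed.

Definition hform n (A : 'M[algC]_n) (v : 'rV_n) : algC := (v *m A *m v^t*) 0 0.

Lemma hform_diag n (d v : 'rV[algC]_n) :
  hform (diag_mx d) v = \sum_j d 0 j * `|v 0 j| ^+ 2.
Proof.
rewrite /hform mxE; apply: eq_bigr => j _.
by rewrite mul_mx_diag !mxE normCK mulrA [v 0 j * d 0 j]mulrC.
Qed.

(** If the eigenvalue at position [n - m], counted from 0, exceeded [c], fewer than
    [m] eigenvalues would be at most [c]. Then some nonzero combination of the [m]
    rows of [M] would have no component along the corresponding eigenvectors, and
    on it the form of [A] would exceed [c] times the squared norm. *)
Lemma eigenvalue_min_max n m (A : 'M[algC]_n) (M : 'M[algC]_(m, n)) c :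
    A \is hermsymmx -> {subset eigenvalues A <= Num.real} ->
    sorted >=%R (eigenvalues A) -> c \is Num.real -> (0 < m)%N -> row_free M ->
    (forall u, hform A (u *m M) <= c * hform 1%:M (u *m M)) ->
  nth 0 (eigenvalues A) (n - m) <= c.
Proof.
move=> hA realA sortA realc m_gt0 freeM boundM.
have le_mn : (m <= n)%N by rewrite -(eqP freeM) rank_leq_col.
set s := eigenvalues A in realA sortA *.
have size_s : size s = n by apply: size_eigenvalues.
have lt_s : (n - m < size s)%N by rewrite size_s ltn_subrL m_gt0 (leq_trans m_gt0).
rewrite real_leNgt ?(realA _ (mem_nth 0 lt_s)) //; apply/negP => gtc.
pose d := spectral_diag A; pose P := spectralmx A.
have normA := hermitian_normalmx hA.
have /orthomx_spectralP eqA := normA; rewrite -/d -/P in eqA.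
have Pu : P \in unitmx by apply: spectral_unit.
have PP : P *m P^t* = 1%:M by apply/unitarymxP/spectral_unitarymx.
have reald j : d 0 j \is Num.real by apply: (mxOverP (hermitian_spectral_diag_real hA)).
pose J := [set j | d 0 j <= c].
have cardJ : (#|J| < m)%N.
  have -> : #|J| = count (<= c) s.
    rewrite (permP (eigenvalues_spectral normA)) count_map cardE size_filter.
    by rewrite enumT; apply: eq_count => j; rewrite /= inE.
  rewrite -(cat_take_drop (n - m).+1 s) count_cat.
  have /eqP-> : count (<= c) (take (n - m).+1 s) == 0%N.
    rewrite -leqn0 leqNgt -has_count; apply/hasPn => x /(nthP 0)[i].
    rewrite size_take size_s => lti <-.
    have {}lti : (i <= n - m)%N by case: ifP lti; lia.
    rewrite nth_take //; apply: contraTN gtc => /=; apply: contraTN => gtc.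
    have : nth 0 s (n - m) <= nth 0 s i.
      apply: (sorted_leq_nth _ _ 0 sortA) => //; last by rewrite inE (leq_ltn_trans lti).
      - by move=> a1 a2 a3 /= a21 a13; apply: le_trans a21.
      - by move=> a1; apply: lexx.
    by move=> /(lt_le_trans gtc) gti; rewrite lt_geF.
  rewrite add0n; apply: leq_ltn_trans (count_size _ _) _; rewrite size_drop size_s.
  lia.
pose N := M *m invmx P.
pose N' := colsub (fun k : 'I_#|J| => enum_val k) N.
have : kermx N' != 0.
  rewrite kermx_eq0 /row_free neq_ltn; apply/orP; left.
  exact: leq_ltn_trans (rank_leq_col _) cardJ.
case/rowV0Pn => u /sub_kermxP uN' u0.
pose y := u *m N.
have uM : u *m M = y *m P by rewrite /y /N !mulmxA mulmxKV.
have yJ j : j \in J -> y 0 j = 0.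
  move=> jJ; have /rowP/(_ (enum_rank_in jJ j)) := uN'.
  rewrite mxE [RHS]mxE => uNj; rewrite -[RHS]uNj /y mxE; apply: eq_bigr => i _.
  by rewrite [in RHS]mxE enum_rankK_in.
have y0 : y != 0.
  apply: contraNneq u0 => y0; apply/eqP/(row_free_inj freeM).
  by rewrite mul0mx uM y0 mul0mx.
clearbody y.
have formy (B : 'M_n) : hform (invmx P *m B *m P) (y *m P) = hform B y.
  rewrite /hform trmx_mul map_mxM !mulmxA -(mulmxA y P) mulmxV // mulmx1.
  by rewrite -[_ *m P *m P^t*]mulmxA PP mulmx1.
have := boundM u; rewrite uM eqA formy.
have -> : hform 1%:M (y *m P) = hform 1%:M y.
  by rewrite -[RHS]formy mulmx1 mulVmx.
have -> : 1%:M = diag_mx (const_mx 1) :> 'M[algC]_n by rewrite diag_const_mx.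
rewrite !hform_diag mulr_sumr -subr_ge0 -sumrB.
apply/negP; rewrite lt_geF // -oppr_gt0 -sumrN.
have term_ge0 j :
    0 <= - (c * (const_mx 1 0 j * `|y 0 j| ^+ 2) - d 0 j * `|y 0 j| ^+ 2).
  rewrite !mxE mul1r opprB -mulrBl; have [jJ|jJ] := boolP (j \in J).
    by rewrite yJ // normr0 expr0n mulr0.
  rewrite mulr_ge0 ?exprn_ge0 // subr_ge0; apply: ltW.
  by rewrite real_ltNge //; rewrite inE in jJ.
have /rV0Pn[j yj] := y0.
rewrite (bigD1 j) //= ltr_wpDr ?sumr_ge0 //.
rewrite !mxE mul1r opprB -mulrBl mulr_gt0 ?exprn_gt0 ?normr_gt0 // subr_gt0.
rewrite real_ltNge //; apply: contraNN yj => jc.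
by rewrite yJ ?inE.
Qed.

End Spectral.

(** * The Laplacian form and disjoint sets with small cuts *)

Section LaplacianForm.

Local Open Scope ring_scope.
Local Open Scope sesquilinear_scope.

Variables (T : finType) (e : rel T).
Hypothesis e_sym : symmetric e.

(** The factor 2 is due to each edge giving two ordered pairs. *)
Lemma laplacian_form (v : 'rV[algC]_#|T|) :
  2 * hform (laplacian_mx e) v =
  \sum_(p : T * T | e p.1 p.2) `|v 0 (enum_rank p.1) - v 0 (enum_rank p.2)| ^+ 2.
Proof.
pose f x := v 0 (enum_rank x).
rewrite -(pair_big_dep xpredT e (fun x y => `|f x - f y| ^+ 2)) /=.
pose D := \sum_x \sum_(y | e x y) `|f x| ^+ 2.
pose C := \sum_x \sum_(y | e x y) f x * (f y)^*.
have swap (F : T -> T -> algC) :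
    \sum_x \sum_(y | e x y) F x y = \sum_x \sum_(y | e x y) F y x.
  rewrite (exchange_big_dep predT) //=; apply: eq_bigr => x _.
  by apply: eq_bigl => y; rewrite e_sym.
have -> : \sum_x \sum_(y | e x y) `|f x - f y| ^+ 2 = 2 * (D - C).
  have D2 : D = \sum_x \sum_(y | e x y) `|f y| ^+ 2 by apply: swap.
  have C2 : C = \sum_x \sum_(y | e x y) f y * (f x)^* by apply: swap.
  have -> : 2 * (D - C) = (D - C) + (D - C) by ring.
  rewrite {2}D2 {2}C2 -!sumrB -big_split; apply: eq_bigr => x _ /=.
  rewrite -!sumrB -big_split; apply: eq_bigr => y _ /=.
  by rewrite !normCK rmorphB /=; ring.
congr (_ * _); rewrite /hform mxE (reindex _ (onW_bij _ (@enum_rank_bij T))) /=.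
rewrite /laplacian_mx mulmxBr mul_mx_diag.
have -> : C = \sum_y (\sum_(x | e x y) f x) * (f y)^*.
  rewrite /C (exchange_big_dep predT) //=; apply: eq_bigr => y _.
  by rewrite mulr_suml.
rewrite /D -sumrB; apply: eq_bigr => y _.
rewrite !mxE mulrBl enum_rankK; congr (_ - _ * _).
  rewrite sumr_const normCK -/(f y) /degree cardsE -mulr_natr; ring.
rewrite (reindex _ (onW_bij _ (@enum_rank_bij T))) /= [RHS]big_mkcond.
apply: eq_bigr => x _; rewrite mxE !enum_rankK -/(f x).
by case: (e x y); rewrite ?mulr1 ?mulr0.
Qed.

Lemma normB_sqr_le (a b : algC) : `|a - b| ^+ 2 <= 2 * `|a| ^+ 2 + 2 * `|b| ^+ 2.
Proof.
have -> : 2 * `|a| ^+ 2 + 2 * `|b| ^+ 2 = `|a - b| ^+ 2 + `|a + b| ^+ 2.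
  by rewrite !normCK rmorphB rmorphD /=; ring.
by rewrite lerDl exprn_ge0.
Qed.

(** The test space is spanned by the indicator vectors of the sets [S i]. If f
    takes the value a_i on [S i] and 0 elsewhere, then an edge xy contributes
    |f x - f y|^2 <= 2 |f x|^2 + 2 |f y|^2, and nothing when both ends are in
    the same [S i]; only edges leaving [S i] are charged to |a_i|^2. *)
Theorem mu_disjoint_sets m (S : 'I_m -> {set T}) (c : algC) :
    (0 < m)%N -> c \is Num.real ->
    (forall i, S i != set0) -> (forall i j, i != j -> [disjoint S i & S j]) ->
    (forall i, 2 * (cut e (S i))%:R <= c * #|S i|%:R) ->
  nth 0 (eigenvalues (laplacian_mx e)) (#|T| - m) <= c.
Proof.
move=> m_gt0 realc S0 disS leS.
pose M : 'M[algC]_(m, #|T|) := \matrix_(i, j) (enum_val j \in S i)%:R.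
have uniqS i j x : x \in S i -> x \in S j -> i = j.
  move=> xi xj; apply/eqP; apply: contraT => /disS/disjointFr/(_ xi).
  by rewrite xj.
have fE (u : 'rV_m) x i : x \in S i -> (u *m M) 0 (enum_rank x) = u 0 i.
  move=> xS; rewrite mxE (bigD1 i) //= mxE enum_rankK xS mulr1 big1 ?addr0 // => j neji.
  rewrite mxE enum_rankK; case: (boolP (x \in S j)) => [xj|_]; last by rewrite mulr0.
  by rewrite (uniqS _ _ _ xj xS) eqxx in neji.
have f0 (u : 'rV_m) x : (forall i, x \notin S i) -> (u *m M) 0 (enum_rank x) = 0.
  by move=> xS; rewrite mxE big1 // => i _; rewrite mxE enum_rankK (negPf (xS i)) mulr0.
apply: (@eigenvalue_min_max _ m _ M) => //.
- exact: laplacian_hermitian.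
- exact: laplacian_eigenvalues_real.
- exact: laplacian_eigenvalues_sorted.
- apply: inj_row_free => u uM; apply/rowP => i; have /set0Pn[x xS] := S0 i.
  by rewrite -(fE u x i xS) uM !mxE.
move=> u; set v := u *m M.
pose f x := v 0 (enum_rank x).
pose arc i x y : algC := ((x \in S i) && (y \notin S i))%:R.
have normE x : `|f x| ^+ 2 = \sum_i `|u 0 i| ^+ 2 * (x \in S i)%:R.
  case: (pickP (fun i => x \in S i)) => [i xi|xS].
    rewrite /f /v (fE u x i xi) (bigD1 i) //= xi mulr1 big1 ?addr0 // => j neji.
    case: (boolP (x \in S j)) => [xj|_]; last by rewrite mulr0.
    by rewrite (uniqS _ _ _ xj xi) eqxx in neji.
  rewrite /f /v f0 => [|i]; last by rewrite xS.
  by rewrite normr0 expr0n big1 // => i _; rewrite xS mulr0.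
have normf x y : (forall i, x \in S i -> y \notin S i) ->
    `|f x| ^+ 2 = \sum_i `|u 0 i| ^+ 2 * arc i x y.
  move=> sep; rewrite normE; apply: eq_bigr => i _; rewrite /arc.
  by case: (boolP (x \in S i)) => // /sep->.
have term x y : `|f x - f y| ^+ 2 <=
    2 * \sum_i `|u 0 i| ^+ 2 * (arc i x y + arc i y x).
  case: (pickP (fun i => (x \in S i) && (y \in S i))) => [i /andP[xi yi]|sep].
    rewrite /f /v (fE u x i xi) (fE u y i yi) subrr normr0 expr0n /=.
    by rewrite mulr_ge0 // sumr_ge0 // => j _; rewrite mulr_ge0 ?exprn_ge0 // addr_ge0.
  have -> : \sum_i `|u 0 i| ^+ 2 * (arc i x y + arc i y x)
      = `|f x| ^+ 2 + `|f y| ^+ 2.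
    rewrite (normf x y) => [|i xi]; last by have := sep i; rewrite xi => /negbT.
    rewrite (normf y x) => [|i yi]; last by have := sep i; rewrite yi andbT => /negbT.
    by rewrite -big_split; apply: eq_bigr => i _; rewrite /= mulrDr.
  by rewrite mulrDr normB_sqr_le.
rewrite -(ler_pM2l (ltr0n _ 2)) laplacian_form.
apply: (le_trans (ler_sum _ (fun p _ => term p.1 p.2))).
rewrite -mulr_sumr ler_pM2l // exchange_big /=.
have -> : hform 1%:M v = \sum_i `|u 0 i| ^+ 2 * #|S i|%:R.
  have -> : 1%:M = diag_mx (const_mx 1) :> 'M[algC]_#|T| by rewrite diag_const_mx.
  rewrite hform_diag (reindex _ (onW_bij _ (@enum_rank_bij T))) /=.
  under eq_bigr => x _ do rewrite mxE mul1r -/(f x) normE.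
  rewrite exchange_big; apply: eq_bigr => i _ /=.
  rewrite -mulr_sumr -sum1_card natr_sum [in RHS]big_mkcond; congr (_ * _).
  by apply: eq_bigr => x _; case: (x \in S i).
rewrite mulr_sumr; apply: ler_sum => i _.
rewrite -mulr_sumr mulrCA ler_wpM2l ?exprn_ge0 //.
apply: le_trans (leS i); rewrite big_split /=.
have cutE (A : {set T}) : \sum_(p : T * T | e p.1 p.2) ((p.1 \in A) && (p.2 \notin A))%:R
    = (cut e A)%:R :> algC by rewrite /cut natr_sum.
rewrite cutE mulr2n mulrDl mul1r lerD2l -(cutC e_sym) -cutE.
by apply: ler_sum => p _; rewrite !inE negbK andbC.
Qed.

End LaplacianForm.

(** * Partitions of graphs without four disjoint islands *)

Lemma other_two (I : finType) (X : {set I}) x : x \in X -> #|X| = 3 ->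
  exists y z, [/\ y \in X, z \in X, y != x, z != x & y != z].
Proof.
move=> xX X3; have /eqP/cards2P[y [z [yz eX]]] : #|X :\ x| = 2.
  by have := cardsD1 x X; rewrite xX X3 => -[].
have : y \in X :\ x by rewrite eX set21.
have : z \in X :\ x by rewrite eX set22.
by move=> /setD1P[zx zX] /setD1P[yx yX]; exists y, z.
Qed.

Section Partitions.

Variables (T : finType) (e : rel T) (k : nat).
Hypotheses (e_sym : symmetric e) (e_irr : irreflexive e).
Implicit Types (A B S U : {set T}) (P Q : {set {set T}}).

Local Notation d := (min_degree e).
Local Notation kappa := (edge_connectivity e).

(** The bound 4k+3 is what a violating partition allows for the total cut of its
    parts with cut at most 2k+1, and it is still small enough for
    [no_four_islands_mu]. *)
Definition island S := (d < #|S|) && (cut e S <= 4 * k + 3).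

Definition no_four_islands := forall s : seq {set T},
  pairwise (fun A B => [disjoint A & B]) s -> all island s -> size s <= 3.

Hypotheses (d_ge : 3 * k + 3 <= d) (islands_le3 : no_four_islands).

(** Fewer vertices would force a cut of at least [d], which exceeds 2k+1. *)
Lemma island_small_cut S : S != set0 -> cut e S <= 2 * k + 1 -> island S.
Proof.
move=> S0 cutS; apply/andP; split; last lia.
by apply: cut_gt_card => //; lia.
Qed.

Lemma pairwise_enum Q :
  trivIset Q -> pairwise (fun A B => [disjoint A & B]) (enum Q).
Proof.
move=> /trivIsetP tQ; have := enum_uniq Q; rewrite uniq_pairwise.
apply: (sub_in_pairwise (P := mem Q)) => [A B AQ BQ /= /(tQ A B AQ BQ) //|].
by apply/allP => A; rewrite mem_enum.
Qed.

Section Extremal.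

Variable V : 'I_3 -> {set T}.
Hypotheses (V0 : forall i, V i != set0)
  (disV : forall i j, i != j -> [disjoint V i & V j])
  (cutV : forall i, cut e (V i) = kappa).

Let R := ~: \bigcup_i V i.

Lemma cut_outside : cut e R <= 3 * kappa.
Proof.
rewrite /R cutC //; apply: leq_trans (cut_bigcup _ _ _) _.
by rewrite (eq_bigr _ (fun i _ => cutV i)) sum_nat_const card_ord.
Qed.

Section ThreeParts.

Variable P : {set {set T}}.
Hypotheses (partP : partition P [set: T]) (P3 : #|P| = 3)
  (cutP : forall S, S \in P -> cut e S <= 2 * k + 1)
  (kappa_le : kappa <= 2 * k + 1).

Let disP A B : A \in P -> B \in P -> A != B -> [disjoint A & B].
Proof. by case/and3P: partP => _ /trivIsetP tP _; apply: tP. Qed.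

Let P0 S : S \in P -> S != set0.
Proof. by case/and3P: partP => _ _ nP; apply: contraTneq => ->. Qed.

Let islandV i : island (V i).
Proof. by apply: island_small_cut; rewrite ?cutV. Qed.

Let islandP S : S \in P -> island S.
Proof. by move=> SP; apply: island_small_cut; [apply: P0|apply: cutP]. Qed.

(** Otherwise the two other parts lie inside [V j], and together with the two
    other sets V they are four disjoint islands. *)
Lemma part_union_proper U j : U \in P -> U :|: V j != [set: T].
Proof.
move=> UP; apply/eqP => UV.
have [A [B [AP BP AU BU AB]]] := other_two UP P3.
have [i [h [_ _ ij hj ih]]] := other_two (in_setT j) (etrans (cardsT _) (card_ord 3)).
have sub S : S \in P -> S != U -> S \subset V j.
  move=> SP SU; apply/subsetP => x xS; have := in_setT x; rewrite -UV inE.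
  by rewrite (disjointFr (disP SP UP SU) xS).
have disS S l : S \in P -> S != U -> l != j -> [disjoint S & V l].
  move=> SP SU lj; apply: disjointWl (sub S SP SU) _.
  by apply: disV; rewrite eq_sym.
have := @islands_le3 [:: A; B; V i; V h].
by rewrite /= !islandV !islandP // disV // disP // !disS //= => /(_ isT isT).
Qed.

Lemma cut_cell U j : U \in P -> cut e (U :&: V j) <= 2 * k + 1.
Proof.
move=> UP; have := cut_submodular e U (V j); rewrite cutV.
have : kappa <= cut e (U :|: V j).
  apply: edge_connectivity_leq => //; last first.
    by rewrite properT part_union_proper.
  have /set0Pn[x xV] := V0 j; apply/set0Pn; exists x.
  by rewrite inE xV orbT.
have := cutP UP; lia.
Qed.

(** The intersections of [A] and [B] with [V j] would be two islands, next to the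
    two other sets V. *)
Lemma meet_unique A B j : A \in P -> B \in P ->
  A :&: V j != set0 -> B :&: V j != set0 -> A = B.
Proof.
move=> AP BP AV BV; apply/eqP/negPn/negP => AB.
have [i [h [_ _ ij hj ih]]] := other_two (in_setT j) (etrans (cardsT _) (card_ord 3)).
have disS S l : l != j -> [disjoint S :&: V j & V l].
  by move=> lj; apply: disjointWl (subsetIr _ _) _; apply: disV; rewrite eq_sym.
have disAB : [disjoint A :&: V j & B :&: V j].
  apply: disjointWl (subsetIl _ _) _; apply: disjointWr (subsetIl _ _) _.
  exact: disP.
have := @islands_le3 [:: A :&: V j; B :&: V j; V i; V h].
rewrite /= disAB disV // !disS // !islandV !island_small_cut ?cut_cell //=.
by move=> /(_ isT isT).
Qed.

(** Otherwise [U] and the three sets V are four disjoint islands. *)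
Lemma part_meets U : U \in P -> exists j, U :&: V j != set0.
Proof.
move=> UP; case: (pickP (fun j => U :&: V j != set0)) => [j UV|UV]; first by exists j.
have disU j : [disjoint U & V j] by rewrite -setI_eq0 -[_ == _]negbK UV.
have := @islands_le3 [:: U; V ord0; V 1%R; V 2%:R%R].
by rewrite /= !disU !disV // !islandV islandP //= => /(_ isT isT).
Qed.

(** By [meet_unique] no other part meets a V that [U] meets; if there were two such
    V, both other parts would have to meet the third one. *)
Lemma meets_one U i j : U \in P -> U :&: V i != set0 -> U :&: V j != set0 -> i = j.
Proof.
move=> UP Ui Uj; apply/eqP/negPn/negP => ij.
have [A [B [AP BP AU BU AB]]] := other_two UP P3.
have [a Aa] := part_meets AP; have [b Bb] := part_meets BP.
have away S l h :
    S \in P -> S != U -> S :&: V l != set0 -> U :&: V h != set0 -> l != h.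
  move=> SP SU Sl Uh; apply: contra SU => /eqP elh; rewrite -elh in Uh.
  by apply/eqP; apply: meet_unique Sl Uh.
have eab : a = b.
  have := away A a i AP AU Aa Ui; have := away A a j AP AU Aa Uj.
  have := away B b i BP BU Bb Ui; have := away B b j BP BU Bb Uj.
  have := ltn_ord a; have := ltn_ord b; have := ltn_ord i; have := ltn_ord j.
  move: ij; rewrite -!val_eqE /= => *; apply: val_inj => /=; lia.
rewrite -eab in Bb.
by move/eqP: AB; apply; apply: meet_unique Aa Bb.
Qed.

(** The part [U] of a vertex of [R] meets exactly one [V j], and what remains of
    [U] is a nonempty subset of [R], with cut at least [d]. By submodularity this
    cut is at most the cut of [U] plus [kappa]; the two other parts have cut at
    least [kappa]. *)
Lemma three_parts_sum : R != set0 -> #|R| <= d ->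
  d + kappa <= \sum_(S in P) cut e S.
Proof.
case/set0Pn => z zR Rd; have /and3P[/eqP covP tP _] := partP.
have zcov : z \in cover P by rewrite covP.
pose U := pblock P z; have UP : U \in P by apply: pblock_mem.
have zU : z \in U by rewrite mem_pblock.
have [j Uj] := part_meets UP.
have zV i : z \notin V i.
  by apply: contraTN zR => zi; rewrite inE negbK; apply/bigcupP; exists i.
have UVR : U :\: V j \subset R.
  apply/subsetP => x /setDP[xU xj]; rewrite inE; apply/bigcupP => -[i _ xi].
  have eij : i = j.
    by apply: meets_one UP _ Uj; apply/set0Pn; exists x; rewrite inE xU.
  by rewrite eij (negPf xj) in xi.
have UV0 : U :\: V j != set0 by apply/set0Pn; exists z; rewrite inE zU zV.
have cutUV : d <= cut e (U :\: V j).
  by apply: small_set_cut => //; apply: leq_trans (subset_leq_card UVR) Rd.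
have cutU : d <= cut e U + kappa.
  apply: leq_trans cutUV _; rewrite -(cutV j) -(cutC e_sym (V j)) setDE.
  by apply: leq_trans (cut_submodular e U (~: V j)); apply: leq_addr.
rewrite (big_setD1 U) //=.
have : \sum_(S in P :\ U) kappa <= \sum_(S in P :\ U) cut e S.
  apply: leq_sum => S /setD1P[SU SP]; apply: edge_connectivity_leq => //.
    exact: P0.
  apply/properP; split; first exact: subsetT.
  exists z; rewrite // (disjointFr (disP UP SP _) zU) // eq_sym.
  by [].
have -> : \sum_(S in P :\ U) kappa = 2 * kappa.
  by rewrite sum_nat_const; have := cardsD1 U P; rewrite UP P3 add1n => -[<-].
by move=> sum_ge; apply: leq_trans (leq_add (leqnn _) sum_ge); lia.
Qed.

End ThreeParts.

(** A violating partition is reduced to one with exactly three parts, all of cut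
    at most 2k+1, which contradicts [three_parts_sum]. *)
Theorem sum_cut_partition P : R != set0 -> partition P [set: T] ->
  2 * k.+1 * #|P|.-1 <= \sum_(S in P) cut e S.
Proof.
move=> R0 partP; have /and3P[/eqP covP tP nP] := partP.
rewrite leqNgt; apply/negP => viol.
have disP A B : A \in P -> B \in P -> A != B -> [disjoint A & B].
  by move/trivIsetP: tP; apply.
have P0 S : S \in P -> S != set0 by apply: contraTneq => ->.
have P_gt1 : 1 < #|P| by move: viol; case: #|P| => [|[|?]] //; rewrite muln0.
have kappaP S : S \in P -> kappa <= cut e S.
  move=> SP; apply: edge_connectivity_leq => //; first exact: P0.
  have [A [B [AP BP AB]]] := card_gt1P P_gt1.
  have [C [CP CS]] : exists C, C \in P /\ C != S.
    by case: (eqVneq A S) AB => [<-|AS _]; [exists B; rewrite eq_sym|exists A].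
  have /set0Pn[x xC] := P0 C CP.
  apply/properP; split; [exact: subsetT|exists x => //].
  by rewrite (disjointFr (disP C S CP SP CS) xC).
pose Q := [set S in P | cut e S <= 2 * k + 1].
have sQP : Q \subset P by apply/subsetP => S /setIdP[].
have tQ : trivIset Q by apply: trivIsetS tP.
have islandQ S : S \in Q -> island S.
  by case/setIdP => SP; apply: island_small_cut; apply: P0.
have Q_le3 : #|Q| <= 3.
  rewrite cardE islands_le3 ?pairwise_enum //.
  by apply/allP => S; rewrite mem_enum; apply: islandQ.
have splitP :
    \sum_(S in P) cut e S = \sum_(S in Q) cut e S + \sum_(S in P :\: Q) cut e S.
  by rewrite (big_setID Q) /= (setIidPr sQP).
have cardPQ : #|P| = #|Q| + #|P :\: Q| by rewrite -(cardsID Q P) (setIidPr sQP).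
have sumQ : #|Q| * kappa <= \sum_(S in Q) cut e S.
  by rewrite -sum_nat_const; apply: leq_sum => S /(subsetP sQP)/kappaP.
have sumPQ : #|P :\: Q| * (2 * k + 2) <= \sum_(S in P :\: Q) cut e S.
  rewrite -sum_nat_const; apply: leq_sum => S /setDP[SP].
  by rewrite inE SP /=; lia.
have sumQ_lt : \sum_(S in Q) cut e S < 2 * k.+1 * #|Q|.-1 /\ 1 < #|Q|.
  move: viol sumQ sumPQ; rewrite splitP cardPQ.
  move: (\sum_(S in Q) _) (\sum_(S in P :\: Q) _) #|Q| #|P :\: Q| => sq sr q r.
  case: q => [|[|q]]; rewrite ?add0n /=; last first; first by nia.
    nia.
  by case: r => /= *; nia.
case: sumQ_lt => sumQ_lt Q_gt1.
have kappa3 : 3 * kappa <= 4 * k + 3 /\ \sum_(S in Q) cut e S <= 4 * k + 3.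
  move: sumQ sumQ_lt Q_gt1 Q_le3; move: (\sum_(S in Q) _) #|Q| => sq q.
  case: q => [|[|[|[|q]]]] //=; lia.
case: kappa3 => kappa3 sumQ_le.
have kappa_le : kappa <= 2 * k + 1 by lia.
have islandV i : island (V i) by apply: island_small_cut; rewrite ?cutV.
have Rd : #|R| <= d.
  rewrite leqNgt; apply/negP => Rgt.
  have islandR : island R by rewrite /island Rgt (leq_trans cut_outside).
  have disR i : [disjoint V i & R].
    rewrite -setI_eq0 /R -setDE setD_eq0; exact: bigcup_sup.
  have := @islands_le3 [:: V ord0; V 1%R; V 2%:R%R; R].
  by rewrite /= !disR !disV // !islandV islandR /= => /(_ isT isT).
have kappa_gt : k < kappa.
  by have := small_set_cut e_irr R0 Rd; have := cut_outside; lia.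
have Q3 : #|Q| = 3.
  move: sumQ sumQ_lt Q_gt1 Q_le3; move: (\sum_(S in Q) _) #|Q| => sq q.
  case: q => [|[|[|[|q]]]] //=; lia.
have eQP : Q = P.
  (* If W were large, it would be a fourth island. So a part outside Q has at most
     d vertices, hence cut at least 3k+3, and the violated inequality has no room
     for such a part. *)
  pose W := ~: cover Q.
  have Wd : #|W| <= d.
    rewrite leqNgt; apply/negP => Wgt.
    have islandW : island W.
      rewrite /island Wgt /W cutC //; apply: leq_trans sumQ_le.
      exact: cut_bigcup.
    have := @islands_le3 (W :: enum Q); rewrite /= -cardE Q3 islandW pairwise_enum //.
    rewrite andbT => H; suff: 3 < 3 by [].
    apply: H; apply/allP => S; rewrite mem_enum; last exact: islandQ.
    move=> SQ; rewrite disjoint_sym -setI_eq0 /W -setDE setD_eq0.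
    exact: bigcup_sup.
  have sumPQ3 : #|P :\: Q| * (3 * k + 3) <= \sum_(S in P :\: Q) cut e S.
    rewrite -sum_nat_const; apply: leq_sum => S /setDP[SP SQ].
    apply: leq_trans d_ge _; apply: small_set_cut => //; first exact: P0.
    apply: leq_trans Wd; apply/subset_leq_card/subsetP => x xS.
    rewrite inE; apply/bigcupP => -[S' S'Q xS'].
    have S'P := subsetP sQP _ S'Q.
    have neS : S != S' by apply: contraNneq SQ => ->.
    by rewrite (disjointFr (disP S S' SP S'P neS) xS) in xS'.
  apply/eqP; rewrite eqEcard sQP cardPQ.
  suff : #|P :\: Q| = 0 by lia.
  move: viol sumQ sumPQ3; rewrite splitP cardPQ Q3.
  move: (\sum_(S in Q) _) (\sum_(S in P :\: Q) _) #|P :\: Q| => sq sr r /=.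
  by case: r => // r *; nia.
have := @three_parts_sum P partP _ _ kappa_le R0 Rd.
rewrite -eQP Q3 => H.
suff: d + kappa <= \sum_(S in Q) cut e S by lia.
by apply: H => // S /setIdP[].
Qed.

End Extremal.

End Partitions.

(** * From the eigenvalue to the spanning trees *)

Local Open Scope ring_scope.

(** Four disjoint islands would bound mu_(n-3) by 2 (4k+3) / (d+1), and
    8k+6 <= 9k+8 <= 9 (k + (d-1)/d) because d >= 9. *)
Lemma no_four_islands_mu (T : finType) (e : rel T) (k : nat) :
    symmetric e -> (2 <= k)%N -> (3 * k + 3 <= min_degree e)%N ->
    mu e (#|T| - 3) > 9 * (k%:R + ((min_degree e)%:R - 1) / (min_degree e)%:R)
                        / ((min_degree e)%:R + 1) ->
  no_four_islands e k.
Proof.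
move=> e_sym k_ge2 d_ge mu_gt s dis_s isl_s; rewrite leqNgt; apply/negP => s4.
set d := min_degree e in d_ge mu_gt.
set c := 9 * _ / _ in mu_gt.
have d_gt0 : 0 < d%:R :> algC by rewrite ltr0n; lia.
have d1_gt0 : 0 < d%:R + 1 :> algC by rewrite addr_gt0.
have c_d1 : c * (d%:R + 1) >= (2 * (4 * k + 3))%:R.
  rewrite /c divfK ?gt_eqF // mulrBl divff ?gt_eqF // mul1r.
  have : d%:R^-1 <= 9^-1 :> algC by rewrite lef_pV2 ?posrE // ler_nat; lia.
  rewrite -[_^-1 <= _]subr_ge0 -[_ <= 9 * _]subr_ge0 => d_inv.
  have -> : 9 * (k%:R + (1 - d%:R^-1)) - (2 * (4 * k + 3))%:R
      = k%:R + 9 * (9^-1 - d%:R^-1) + 2 :> algC.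
    by rewrite natrM natrD natrM; field; rewrite gt_eqF.
  by rewrite !addr_ge0 // mulr_ge0.
have c_ge0 : 0 <= c.
  by rewrite -(pmulr_lge0 _ d1_gt0) (le_trans _ c_d1).
pose S (i : 'I_4) := nth set0 s i.
have lt_s (i : 'I_4) : (i < size s)%N by apply: leq_trans s4.
have isl (i : 'I_4) : island e k (S i) by apply: (allP isl_s); apply: mem_nth.
suff le_c : mu e (#|T| - 3) <= c by have := lt_le_trans mu_gt le_c; rewrite ltxx.
rewrite /mu -subnS; apply: (@mu_disjoint_sets _ _ _ 4 S) => //.
  - exact: ger0_real.
  - by move=> i; rewrite -card_gt0; case/andP: (isl i) => /(leq_ltn_trans (leq0n _)).
  - have /pairwiseP dis := dis_s.
    move=> i j; rewrite -val_eqE neq_ltn => /orP[] ij.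
      by apply: dis; rewrite ?inE.
    by rewrite disjoint_sym; apply: dis; rewrite ?inE.
  move=> i; have /andP[Sd cutS] := isl i.
  apply: le_trans (_ : c * (d%:R + 1) <= _); last first.
    by rewrite ler_wpM2l // natr1 ler_nat.
  apply: le_trans c_d1; rewrite -natrM ler_nat leq_mul2l; exact: cutS.
Qed.

Theorem theorem1p3 (k n delta : nat) (T : finType) (e : rel T)
    (e_sym : symmetric e) (e_irr : irreflexive e)
    (k_ge2 : (2 <= k)%N)
    (G_class : in_class_G 2 e)
    (order_n : #|T| = n)
    (min_deg : min_degree e = delta)
    (delta_ge : (3 * k + 3 <= delta)%N)
    (mu_gt : mu e (n - 3) >
       9 * (k%:R + (delta%:R - 1) / delta%:R) / (delta%:R + 1)) :
  property_P k delta e.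
Proof.
subst n delta.
have islands := no_four_islands_mu e_sym k_ge2 delta_ge mu_gt.
have [V [V_proper V_dis V_rest V_cut]] := G_class.
have V0 i : V i != set0 by case: (V_proper i).
have cutV i : cut e (V i) = edge_connectivity e by rewrite (V_cut i) cut_between.
have T_gt1 : (1 < #|T|)%N.
  have [VT0 /proper_card] := V_proper ord0.
  by rewrite cardsT; apply: leq_ltn_trans; rewrite card_gt0.
have [|P partP|t [t_tree t_card t_dis]] := @tree_packing T e k.+1 e_irr.
- exact: ltnW.
- rewrite -(leq_pmul2l (ltn0Sn 1)) mulnA.
  have sumP :=
    sum_cut_partition e_sym e_irr delta_ge islands V0 V_dis cutV V_rest partP.
  exact: leq_trans sumP (sum_cut_crossing e partP).
exists (fun i => t (lift ord0 i)), (t ord0); split.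
- split=> [i|i j neij]; first exact: t_tree.
  by apply: t_dis; rewrite (inj_eq lift_inj).
- by case: (t_tree ord0).
- by move=> i; apply: t_dis.
- rewrite t_card -subn1 natrB ?(ltnW T_gt1) // gtr_pMl ?subr_gt0 ?ltr1n //.
  rewrite ltr_pdivrMr ?ltr0n; last lia.
  by rewrite mul1r gtrBl.
- by case; apply: t_tree.
Qed.
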